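(* Let $n\ge 1$ and $\tau\in W=\mathfrak S_{n+1}$. Then $N(\tau)$ is a rectangular subset of $\Phi^+$ (i.e. $\tau$ is rectangular) if and only if for all $1\le i<k<j<\ell\le n+1$ the following two conditions are equivalent: (i) $\tau(i)>\tau(j)$ and $\tau(k)>\tau(\ell)$; (ii) $\tau(i)>\tau(\ell)$ and $\tau(k)>\tau(j)$.
   Context: $\Phi^+=\{\alpha_{i,j}=\alpha_i+\dots+\alpha_j\mid1\le i\le j\le n\}$ is the set of positive roots of $\mathfrak{sl}_{n+1}$, with Weyl group $W=\mathfrak S_{n+1}$; $N(\tau)=\Phi^+\cap\tau^{-1}(\Phi^-)$, so that $\alpha_{i,j-1}\in N(\tau)$ iff $\tau(i)>\tau(j)$ (for $1\le i<j\le n+1$). The support of $\alpha_{i,j}$ is $\mathrm{supp}(\alpha_{i,j})=\{i,i+1,\dots,j\}\subseteq[n]=\{1,\dots,n\}$; a subset of $[n]$ is connected if it is an interval. The join is $\alpha_{i,j}\vee\alpha_{k,\ell}=\alpha_{\min(i,k),\max(j,\ell)}$. The meet of $\alpha_{i,j}$ and $\alpha_{k,\ell}$ exists iff $\max(i,k)\le\min(j,\ell)$, and then $\alpha_{i,j}\wedge\alpha_{k,\ell}=\alpha_{\max(i,k),\min(j,\ell)}$. A subset $A\subseteq\Phi^+$ is rectangular if: (R1) for any $\alpha,\beta\in A$ with $\mathrm{supp}(\alpha)\cup\mathrm{supp}(\beta)$ connected, $\alpha\vee\beta\in A$, and moreover $\alpha\wedge\beta\in A$ if it exists; and (R2) if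 $\alpha,\beta\in\Phi^+$ are such that $\alpha\wedge\beta$ exists and $\alpha\vee\beta,\alpha\wedge\beta\in A$, then $\alpha,\beta\in A$. An element $\tau\in W$ is called rectangular if $N(\tau)$ is a rectangular subset. *)

(* Defs.v *)
From HB Require Import structures.
From mathcomp Require Import all_boot all_order all_fingroup all_algebra.

Set Implicit Arguments.
Unset Strict Implicit.
Unset Printing Implicit Defensive.

Import Order.TTheory GRing.Theory Num.Theory.

(* Indices are 0-based throughout: [n] = {1, ..., n} is 'I_n, so that the
   simple root alpha_(i+1) has index i : 'I_n, and S_(n+1) is 'S_n.+1. *)

(* [PosRoot i j _] is the positive root alpha_{i,j} = alpha_i + ... + alpha_j
   of sl_(n+1); the vector itself is [root_vec] below. *)
Record posroot (n : nat) := PosRoot {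
  rootidx :> 'I_n * 'I_n;
  rootidxP : (rootidx.1 <= rootidx.2)%N
}.

HB.instance Definition _ (n : nat) := [isSub for @rootidx n].
HB.instance Definition _ (n : nat) := [Finite of posroot n by <:].

Section RootVectors.
Local Open Scope ring_scope.

(* alpha_i = e_i - e_(i+1) in Z^(n+1). *)
Definition simple_root (n : nat) (i : 'I_n) : 'rV[int]_n.+1 :=
  delta_mx 0 (widen_ord (leqnSn n) i) - delta_mx 0 (lift ord0 i).

Definition root_vec (n : nat) (a : posroot n) : 'rV[int]_n.+1 :=
  \sum_(k < n | (a.1 <= k <= a.2)%N) simple_root k.

(* The action of S_(n+1) sending e_i to e_(tau i). *)
Definition weyl_act (n : nat) (tau : 'S_n.+1) (v : 'rV[int]_n.+1) :
  'rV[int]_n.+1 := col_perm tau^-1%g v.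

Definition negative_root (n : nat) (v : 'rV[int]_n.+1) : bool :=
  [exists b : posroot n, v == - root_vec b].

Definition inversions (n : nat) (tau : 'S_n.+1) : {set posroot n} :=
  [set a | negative_root (weyl_act tau (root_vec a))].

End RootVectors.

Definition supp (n : nat) (a : posroot n) : {set 'I_n} :=
  [set k : 'I_n | (a.1 <= k <= a.2)%N].

Definition connected (n : nat) (S : {set 'I_n}) : Prop :=
  exists i j : 'I_n, S = [set k : 'I_n | (i <= k <= j)%N].

Lemma root_join_subproof (n : nat) (a b : posroot n) :
  (Order.min a.1 b.1 <= Order.max a.2 b.2)%N.
Proof.
have le_a : (a.1 <= a.2)%O := rootidxP a.
suff : (Order.min a.1 b.1 <= Order.max a.2 b.2)%O by [].
by rewrite ge_min !le_max le_a.
Qed.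

Definition root_join (n : nat) (a b : posroot n) : posroot n :=
  @PosRoot n (Order.min a.1 b.1, Order.max a.2 b.2) (root_join_subproof a b).

(* [None] when max(i,k) > min(j,l), i.e. when the meet does not exist. *)
Definition root_meet (n : nat) (a b : posroot n) : option (posroot n) :=
  insub (Order.max a.1 b.1, Order.min a.2 b.2).

Definition rectangular (n : nat) (A : {set posroot n}) : Prop :=
  (forall a b : posroot n, a \in A -> b \in A ->
     connected (supp a :|: supp b) ->
     root_join a b \in A /\
     (forall c : posroot n, root_meet a b = Some c -> c \in A))
  /\
  (forall a b c : posroot n, root_meet a b = Some c ->
     root_join a b \in A -> c \in A -> a \in A /\ b \in A).

Definition rectangular_perm (n : nat) (tau : 'S_n.+1) : Prop :=
  rectangular (inversions tau).

(* Main.v *)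
(* Under the bijection [alpha_{i,j} <-> (i, j+1)] between positive roots and
   pairs [p < q], the root lies in [N(tau)] iff [tau] inverts the pair.  For two
   roots whose pairs are nested, join and meet are the two roots themselves; for
   adjacent pairs [(p, q)], [(q, s)] there is only the join, inverted by
   transitivity.  The remaining crossing pairs [p < r < q < s] are exactly where
   (R1) and (R2) have content, and there they are the two implications between
   (i) and (ii). *)
Require Import Defs.
From HB Require Import structures.
From mathcomp Require Import all_boot all_order all_fingroup all_algebra.
From mathcomp Require Import zify.

Set Implicit Arguments.
Unset Strict Implicit.
Unset Printing Implicit Defensive.

Import Order.TTheory GRing.Theory Num.Theory.

Section RootVectors.
Local Open Scope ring_scope.
Variable n : nat.
Implicit Types (p q : 'I_n.+1) (a b : posroot n).

Lemma root_vecE a :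
  root_vec a = delta_mx 0 (inord a.1) - delta_mx 0 (inord a.2.+1).
Proof.
(* The sign makes each simple root the increment [e k.+1 - e k], so that the sum telescopes. *)
pose e (k : nat) : 'rV[int]_n.+1 := - delta_mx 0 (inord k).
have le_a : (a.1 <= a.2.+1)%N by rewrite ltnW // ltnS (rootidxP a).
have -> : root_vec a = \sum_(a.1 <= k < a.2.+1) (e k.+1 - e k).
  rewrite (big_nat_widen _ _ _ _ _ (ltn_ord a.2)) big_geq_mkord.
  apply: eq_big => [k|k _]; first by rewrite ltnS andbC.
  rewrite /simple_root /e opprK addrC.
  by congr (- delta_mx 0 _ + delta_mx 0 _); apply: val_inj;
    rewrite /= ?inordK // ltnS // ltnW.
by rewrite telescope_sumr // /e opprK addrC.
Qed.

Lemma weyl_act_delta (tau : 'S_n.+1) p :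
  weyl_act tau (delta_mx 0 p) = delta_mx 0 (tau p).
Proof.
apply/matrixP=> i j; rewrite !mxE; congr (_ && _)%:R.
by rewrite -(inj_eq (@perm_inj _ tau)) permKV.
Qed.

Lemma weyl_actB (tau : 'S_n.+1) (u v : 'rV[int]_n.+1) :
  weyl_act tau (u - v) = weyl_act tau u - weyl_act tau v.
Proof. by apply/matrixP=> i j; rewrite !mxE. Qed.

Lemma negative_root_delta p q :
  p != q -> negative_root (delta_mx 0 p - delta_mx 0 q) = (q < p)%N.
Proof.
move=> neq_pq; apply/existsP/idP => [[b /eqP]|lt_qp].
  rewrite root_vecE opprB => /matrixP eq_b.
  have lt_b : ((inord b.1 : 'I_n.+1) < (inord b.2.+1 : 'I_n.+1))%N.
    by rewrite !inordK ?ltnS ?(rootidxP b) // ltnW.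
  (* Coordinate [p] is 1 on the left, which forces [p = b.2.+1]; coordinate [q] is -1, which forces
     [q = b.1]. *)
  move: (eq_b 0 p) (eq_b 0 q); rewrite !mxE !eqxx /= (eq_sym q p).
  rewrite (negPf neq_pq).
  case: (p =P inord b.2.+1) => [->|_]; last by case: (_ == _).
  by case: (q =P inord b.1) => [-> //|_] _; case: (_ == _).
have q_n : (q < n)%N by rewrite (leq_trans lt_qp) // -ltnS.
have p_n : (p.-1 < n)%N by have := ltn_ord p; lia.
have le_b : (Ordinal q_n <= Ordinal p_n)%N by move: lt_qp => /=; lia.
(* The root with endpoints [q] and [p.-1] is e_q - e_p. *)
exists (@PosRoot n (Ordinal q_n, Ordinal p_n) le_b).
rewrite root_vecE opprB /= prednK; last by lia.
by rewrite !inord_val.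
Qed.

End RootVectors.

Section Rectangular.
Variables (n : nat) (tau : 'S_n.+1).
Implicit Types a b c : posroot n.

(** Natural-number indices let [a.2.+1], minima and maxima be used without bound proofs; [inord] is
    faithful up to [n]. *)
Let t (m : nat) : nat := tau (inord m).

(** [tau] sends e_p - e_q to e_(tau p) - e_(tau q), here with p = [a.1] and q = [a.2.+1]. *)
Lemma mem_inversions a : (a \in inversions tau) = (t a.2.+1 < t a.1).
Proof.
rewrite inE root_vecE weyl_actB !weyl_act_delta negative_root_delta //.
rewrite (inj_eq perm_inj) -(inj_eq val_inj) /= !inordK ?ltnS //; last exact: ltnW.
by have := rootidxP a; lia.
Qed.

Lemma val_join1 a b : (root_join a b).1 = minn a.1 b.1 :> nat.
Proof. by rewrite /= minElt ltEord /minn; case: ifP. Qed.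

Lemma val_join2 a b : (root_join a b).2 = maxn a.2 b.2 :> nat.
Proof. by rewrite /= maxElt ltEord /maxn; case: ifP. Qed.

Lemma root_meetP a b c :
  root_meet a b = Some c <->
  c.1 = maxn a.1 b.1 :> nat /\ c.2 = minn a.2 b.2 :> nat.
Proof.
have -> : maxn a.1 b.1 = Order.max a.1 b.1 by rewrite maxElt ltEord /maxn; case: ifP.
have -> : minn a.2 b.2 = Order.min a.2 b.2 by rewrite minElt ltEord /minn; case: ifP.
rewrite /root_meet; split=> [|[/val_inj c1 /val_inj c2]].
  by case: insubP => // d _ vd [<-]; move: vd => /= ->.
by rewrite -c1 -c2 -surjective_pairing; exact: (@valK _ _ (posroot n)).
Qed.

(** Two nonempty intervals have an interval as union unless an index separates them; the successors
    admit adjacent supports. The union is then the support of the join. *)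
Lemma connected_suppU a b :
  connected (supp a :|: supp b) <-> a.1 <= b.2.+1 /\ b.1 <= a.2.+1.
Proof.
have le_a := rootidxP a; have le_b := rootidxP b.
split=> [[i [j /setP eqS]]|[le_ab le_ba]]; last first.
  exists (root_join a b).1, (root_join a b).2; apply/setP=> k.
  by rewrite inE [RHS]inE val_join1 val_join2 !inE; lia.
move: (eqS a.1) (eqS a.2) (eqS b.1) (eqS b.2).
rewrite !inE => m1 m2 m3 m4; split; rewrite leqNgt; apply/negP=> lt.
  (* The index [b.2.+1] lies between the two supports but in neither. *)
  have lt_n : b.2.+1 < n by apply: ltn_trans lt _.
  by move: (eqS (Ordinal lt_n)); rewrite !inE /=; lia.
have lt_n : a.2.+1 < n by apply: ltn_trans lt _.
by move: (eqS (Ordinal lt_n)); rewrite !inE /=; lia.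
Qed.

End Rectangular.

Theorem proposition3p10 (n : nat) (hn : (1 <= n)%N) (tau : 'S_n.+1) :
  rectangular_perm tau <->
  (forall i k j l : 'I_n.+1, (i < k)%N -> (k < j)%N -> (j < l)%N ->
     ((tau i > tau j)%N /\ (tau k > tau l)%N <->
      (tau i > tau l)%N /\ (tau k > tau j)%N)).
Proof.
split=> [[R1 R2] i k j l ik kj jl|H].
  have l_n := ltn_ord l.
  have i_n : i < n by lia.
  have k_n : k < n by lia.
  have j_n : j.-1 < n by lia.
  have m_n : l.-1 < n by lia.
  have ij : Ordinal i_n <= Ordinal j_n by rewrite /=; lia.
  have kl : Ordinal k_n <= Ordinal m_n by rewrite /=; lia.
  have kj' : Ordinal k_n <= Ordinal j_n by rewrite /=; lia.
  (* The pairs (i, j), (k, l), (k, j) become [a], [b] and their meet [c], with right endpoints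
     lowered by one; the join of [a] and [b] is the pair (i, l). *)
  pose a := @PosRoot n (Ordinal i_n, Ordinal j_n) ij.
  pose b := @PosRoot n (Ordinal k_n, Ordinal m_n) kl.
  pose c := @PosRoot n (Ordinal k_n, Ordinal j_n) kj'.
  have meet_ab : root_meet a b = Some c by apply/root_meetP => /=; lia.
  have conn_ab : connected (supp a :|: supp b).
    by apply/connected_suppU => /=; lia.
  have Ea : (a \in inversions tau) = (tau j < tau i).
    by rewrite mem_inversions /= prednK ?inord_val //; lia.
  have Eb : (b \in inversions tau) = (tau l < tau k).
    by rewrite mem_inversions /= prednK ?inord_val //; lia.
  have Ec : (c \in inversions tau) = (tau j < tau k).
    by rewrite mem_inversions /= prednK ?inord_val //; lia.
  have Eab : (root_join a b \in inversions tau) = (tau l < tau i).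
    rewrite mem_inversions val_join1 val_join2 /=.
    have -> : (maxn j.-1 l.-1).+1 = l by lia.
    by have -> : minn i k = i; [lia | rewrite !inord_val].
  split=> [[]|[]]; first rewrite -Ea -Eb => ha hb.
    by have [] := R1 a b ha hb conn_ab; rewrite Eab => ? /(_ c meet_ab); rewrite Ec.
  by rewrite -Eab -Ec => hab hc; have := R2 a b c meet_ab hab hc; rewrite Ea Eb.
pose t m : nat := tau (inord m).
(* The hypothesis extends to weak inequalities: for [p = r] or [q = s] both sides have the same two
   conjuncts. *)
have cross p q r s : p <= r < q -> q <= s <= n ->
    (t q < t p) && (t s < t r) = (t s < t p) && (t q < t r).
  move=> /andP[le_pr lt_rq] /andP[le_qs le_sn].
  have [->|neq_pr] := eqVneq p r; first exact: andbC.
  have [->//|neq_qs] := eqVneq q s.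
  have := H (inord p) (inord r) (inord q) (inord s).
  by rewrite !inordK; try lia; move=> E; apply/andP/andP; apply E; lia.
(* For overlapping pairs in any position, nested ones being trivial, this single identity gives (R2)
   and the part of (R1) where the meet exists. *)
have join_meet p q r s : maxn p r < minn q s -> maxn q s <= n ->
    (t q < t p) && (t s < t r)
    = (t (maxn q s) < t (minn p r)) && (t (minn q s) < t (maxn p r)).
  case: (leqP p r) => le_pr; case: (leqP q s) => le_qs lt_rq le_n //.
  - by apply: cross; rewrite ?le_pr ?le_qs.
  - exact: andbC.
  by rewrite andbC; apply: cross; lia.
have in_join (a b : posroot n) : (root_join a b \in inversions tau)
    = (t (maxn a.2.+1 b.2.+1) < t (minn a.1 b.1)).
  by rewrite mem_inversions val_join1 val_join2 maxnSS.
have in_meet a b c : root_meet a b = Some c -> (c \in inversions tau)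
    = (t (minn a.2.+1 b.2.+1) < t (maxn a.1 b.1)).
  by case/root_meetP=> c1 c2; rewrite mem_inversions c1 c2 minnSS.
have lt_meet (a b c : posroot n) : root_meet a b = Some c ->
    maxn a.1 b.1 < minn a.2.+1 b.2.+1.
  by case/root_meetP=> c1 c2; have := rootidxP c; lia.
have le_join (a b : posroot n) : maxn a.2.+1 b.2.+1 <= n.
  by have := ltn_ord a.2; have := ltn_ord b.2; lia.
split=> [a b|a b c meet_ab]; last first.
  rewrite in_join (in_meet _ _ _ meet_ab) !mem_inversions => hj hm.
  by apply/andP; rewrite join_meet ?(lt_meet _ _ _ meet_ab) // hj.
rewrite in_join !mem_inversions -!/(t _) => ha hb /connected_suppU[le_ab le_ba].
have le_a := rootidxP a; have le_b := rootidxP b.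
split=> [|c meet_ab]; last first.
  have : (t a.2.+1 < t a.1) && (t b.2.+1 < t b.1) by rewrite ha.
  by rewrite join_meet ?(lt_meet _ _ _ meet_ab) // (in_meet _ _ _ meet_ab) => /andP[].
have [lt_ab|ge_ab] := ltnP (maxn a.1 b.1) (minn a.2.+1 b.2.+1).
  have : (t a.2.+1 < t a.1) && (t b.2.+1 < t b.1) by rewrite ha.
  by rewrite join_meet // => /andP[].
(* Connected supports without overlap are adjacent, so the join concatenates the two pairs and
   transitivity through the shared index applies. *)
have [eq_ab|eq_ba] : a.1 = b.2.+1 :> nat \/ b.1 = a.2.+1 :> nat by lia.
  have -> : maxn a.2.+1 b.2.+1 = a.2.+1 by lia.
  have -> : minn a.1 b.1 = b.1 by lia.
  by apply: ltn_trans hb; rewrite -eq_ab.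
have -> : maxn a.2.+1 b.2.+1 = b.2.+1 by lia.
have -> : minn a.1 b.1 = a.1 by lia.
by apply: ltn_trans ha; rewrite -eq_ba.
Qed.
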